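(* Let $\mathbb{K}$ be an algebraically closed field of characteristic zero, let $a\in\mathbb{K}^*$, and let $D=aX\dfrac{\partial}{\partial X}+aY\dfrac{\partial}{\partial Y}$, a linear derivation of $\mathbb{K}[X,Y]$. Then \[ \operatorname{Aut}(\mathbb{K}[X,Y])_D=\{(\alpha X+\beta Y,\ \gamma X+\delta Y)\mid \alpha,\beta,\gamma,\delta\in\mathbb{K},\ \alpha\delta-\beta\gamma\neq 0\}. \]
   Context: For a derivation $D$ of $\mathbb{K}[X,Y]$, $\operatorname{Aut}(\mathbb{K}[X,Y])_D$ denotes the isotropy group of $D$: the group of all $\mathbb{K}$-algebra automorphisms $\rho$ of $\mathbb{K}[X,Y]$ with $\rho D=D\rho$. A pair $(F,G)$ of polynomials denotes the $\mathbb{K}$-algebra endomorphism $\rho$ of $\mathbb{K}[X,Y]$ with $\rho(X)=F$ and $\rho(Y)=G$. *)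

(* Defs.v *)
From mathcomp Require Import all_boot all_algebra.
From mathcomp Require Import mpoly.

Set Implicit Arguments.
Unset Strict Implicit.
Unset Printing Implicit Defensive.

Import GRing.Theory.
Local Open Scope ring_scope.

Notation varX := ('X_(0 : 'I_2)) (only parsing).
Notation varY := ('X_(1 : 'I_2)) (only parsing).

Section Defs.

Variable K : comNzRingType.

Notation KXY := {mpoly K[2]}.

Record derivation := Derivation {
  der_fun :> KXY -> KXY;
  der_linear : linear der_fun;
  der_leibniz : forall p q : KXY, der_fun (p * q) = der_fun p * q + p * der_fun q
}.

Definition scaled_euler_fun (a : K) (p : KXY) : KXY :=
  a *: varX * p^`M(0) + a *: varY * p^`M(1).

Lemma scaled_euler_linear a : linear (scaled_euler_fun a).
Proof.
move=> c p q; rewrite /scaled_euler_fun !linearP /= !mulrDr -!scalerAr scalerDr.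
by rewrite addrACA.
Qed.

Lemma scaled_euler_leibniz a p q :
  scaled_euler_fun a (p * q) =
  scaled_euler_fun a p * q + p * scaled_euler_fun a q.
Proof.
rewrite /scaled_euler_fun !mderivM !mulrDr mulrDl addrACA !mulrA.
by rewrite ![p * _]mulrC ![_ * p * _]mulrAC.
Qed.

Definition scaled_euler (a : K) : derivation :=
  Derivation (scaled_euler_linear a) (scaled_euler_leibniz a).

(* Automorphisms are bare functions subject to a predicate, so an equality of
   sets of automorphisms reads as an equivalence of predicates on functions. *)
Definition alg_automorphism (rho : KXY -> KXY) : Prop :=
  [/\ linear rho, monoid_morphism rho & bijective rho].

Definition isotropy (D : derivation) (rho : KXY -> KXY) : Prop :=
  alg_automorphism rho /\ rho \o D =1 D \o rho.

(* The pair (F, G): substitution of F for X and of G for Y. *)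
Definition endo (F G : KXY) (p : KXY) : KXY := p \mPo [tuple F; G].

Lemma endo_linear F G : linear (endo F G).
Proof. by move=> c p q; rewrite /endo linearP. Qed.

Lemma endo_monoid_morphism F G : monoid_morphism (endo F G).
Proof. by split=> [|p q]; rewrite /endo ?rmorph1 ?rmorphM. Qed.

Lemma endo_varX F G : endo F G varX = F.
Proof. by rewrite /endo comp_mpolyXU. Qed.

Lemma endo_varY F G : endo F G varY = G.
Proof. by rewrite /endo comp_mpolyXU. Qed.

End Defs.

(* Main.v *)
Require Import Defs.
From mathcomp Require Import all_boot all_algebra.
From mathcomp Require Import mpoly.
From mathcomp Require Import ring.

(* Reading off coefficients, D multiplies the homogeneous component of degree d
   by a d, so in characteristic zero the eigenspace of D for the eigenvalue a
   consists of the linear forms. An endomorphism rho commutes with D exactly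
   when this holds on the generators, i.e. when rho X and rho Y lie in that
   eigenspace; it is then bijective if and only if its matrix is invertible. *)

Set Implicit Arguments.
Unset Strict Implicit.
Unset Printing Implicit Defensive.

Import GRing.Theory.
Local Open Scope ring_scope.

Lemma linear_fun0 (R : nzRingType) (U V : lmodType R) (f : U -> V) :
  linear f -> f 0 = 0.
Proof. by move=> fL; have := fL (-1) 0 0; rewrite !scaleN1r !addNr. Qed.

Lemma linear_funZ (R : nzRingType) (U V : lmodType R) (f : U -> V) :
  linear f -> scalable f.
Proof.
by move=> fL c u; have := fL c u 0; rewrite (linear_fun0 fL) !addr0.
Qed.

Section TwoVariables.

Variable R : comNzRingType.
Implicit Types (F G : {mpoly R[2]}) (a : R).

(** The hypotheses make [P] a unital subalgebra containing both variables, hence everything. This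
    carries identities from the two generators to all polynomials. *)
Lemma mpoly2_algebra_ind (P : {mpoly R[2]} -> Prop) :
  P 1 -> (forall c p q, P p -> P q -> P (c *: p + q)) ->
  (forall p q, P p -> P q -> P (p * q)) -> P varX -> P varY -> forall p, P p.
Proof.
move=> P1 PL PM PX PY.
have P0 : P 0 by move: (PL (-1) 1 1 P1 P1); rewrite scaleN1r addNr.
have PXn p n : P p -> P (p ^+ n).
  by move=> Pp; elim: n => [|n IHn]; rewrite ?expr0 // exprS; apply: PM.
elim/mpolyind=> // c m p _ _ Pp; apply: PL Pp.
by rewrite mpolyXE_id big_ord_recl big_ord1; apply: PM; apply: PXn.
Qed.

Lemma alg_morphism_ext (f g : {mpoly R[2]} -> {mpoly R[2]}) :
  linear f -> monoid_morphism f -> linear g -> monoid_morphism g ->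
  f varX = g varX -> f varY = g varY -> f =1 g.
Proof.
move=> fL [f1 fM] gL [g1 gM] fgX fgY.
apply: mpoly2_algebra_ind => // [|c p q fgp fgq|p q fgp fgq].
- by rewrite f1 g1.
- by rewrite fL gL fgp fgq.
- by rewrite fM gM fgp fgq.
Qed.

Lemma derivation1 (D : derivation R) : D 1 = 0.
Proof.
have := der_leibniz D 1 1; rewrite !mulr1 mul1r => /eqP.
by rewrite eq_sym -subr_eq0 addrK => /eqP.
Qed.

(** Both composites obey the Leibniz rule twisted by [f], sending [p * q] to
    [h p * f q + f p * h q], so the polynomials on which they agree form a subalgebra. *)
Lemma commute_derivation (D : derivation R) (f : {mpoly R[2]} -> {mpoly R[2]}) :
  linear f -> monoid_morphism f ->
  f (D varX) = D (f varX) -> f (D varY) = D (f varY) -> f \o D =1 D \o f.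
Proof.
move=> fL [f1 fM] fX fY.
have fD p q : f (p + q) = f p + f q by have := fL 1 p q; rewrite !scale1r.
apply: mpoly2_algebra_ind => //= [|c p q fp fq|p q fp fq].
- by rewrite f1 derivation1 linear_fun0.
- by rewrite der_linear !fL der_linear fp fq.
- by rewrite fM !der_leibniz fD !fM fp fq.
Qed.

(** Euler's identity: ['X_i] times the [i]-th partial derivative scales a monomial by its exponent
    in ['X_i], and the two exponents add up to the degree. *)
Lemma mcoeff_scaled_euler a p m :
  (scaled_euler a p)@_m = a * (mdeg m)%:R * p@_m.
Proof.
have XD i k : 'X_i * ('X_[k] : {mpoly R[2]})^`M(i) = (k i)%:R *: 'X_[k].
  rewrite mderivX -scalerAr -mpolyXD.
  (* Subtraction of exponents is truncated, so multiplying back by ['X_i] recovers ['X_[k]] only if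
     [k i] is positive; otherwise the scalar factor is zero. *)
  have [->|ki] := eqVneq (k i) 0%N; first by rewrite !scale0r.
  by rewrite addmC submK // lep1mP.
elim/mpolyind: p => [|c k p _ _ IHp].
  by rewrite /= /scaled_euler_fun !mderiv0 !mulr0 addr0 !mcoeff0 mulr0.
rewrite der_linear mcoeffD IHp [in RHS]mcoeffD !mcoeffZ mulrDr; congr (_ + _).
rewrite /= /scaled_euler_fun -!scalerAl !XD -scalerDr -scalerDl !mcoeffZ.
rewrite mcoeffX; have [->|_] := eqVneq k m; last by rewrite !mulr0.
rewrite mdegE big_ord_recl big_ord1 natrD.
have -> : lift ord0 ord0 = 1 :> 'I_2 by apply: val_inj.
by rewrite [LHS]mulrCA -mulrA; congr (_ * _); apply: mulrCA.
Qed.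

Lemma scaled_euler_varX a : scaled_euler a varX = a *: varX.
Proof.
apply/mpolyP=> m; rewrite mcoeff_scaled_euler mcoeffZ mcoeffX.
by case: eqP => [<-|_]; rewrite ?mdeg1 ?mulr1 // !mulr0.
Qed.

Lemma scaled_euler_varY a : scaled_euler a varY = a *: varY.
Proof.
apply/mpolyP=> m; rewrite mcoeff_scaled_euler mcoeffZ mcoeffX.
by case: eqP => [<-|_]; rewrite ?mdeg1 ?mulr1 // !mulr0.
Qed.

Definition linform (x y : R) : {mpoly R[2]} := x *: varX + y *: varY.

Lemma linformX : linform 1 0 = varX.
Proof. by rewrite /linform scale1r scale0r addr0. Qed.

Lemma linformY : linform 0 1 = varY.
Proof. by rewrite /linform scale1r scale0r add0r. Qed.

Lemma scaled_euler_linform a x y :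
  scaled_euler a (linform x y) = a *: linform x y.
Proof.
have L := der_linear (scaled_euler a).
rewrite /linform L (linear_funZ L) scaled_euler_varX scaled_euler_varY.
by rewrite scalerDr !scalerA ![a * _]mulrC.
Qed.

Lemma linform_eq0 x y : linform x y = 0 -> x = 0 /\ y = 0.
Proof.
move=> e; split.
  have := congr1 (mcoeff U_(0)) e.
  by rewrite linearD !linearZ /= !mcoeffXU mcoeff0 mulr1 mulr0 addr0.
have := congr1 (mcoeff U_(1)) e.
by rewrite linearD !linearZ /= !mcoeffXU mcoeff0 mulr1 mulr0 add0r.
Qed.

Lemma endo_linform F G x y : endo F G (linform x y) = x *: F + y *: G.
Proof.
have L := endo_linear F G.
by rewrite /linform L (linear_funZ L) endo_varX endo_varY.
Qed.

Lemma linform_comb c d x y x' y' :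
  c *: linform x y + d *: linform x' y' =
  linform (c * x + d * x') (c * y + d * y').
Proof. by rewrite /linform !scalerDr !scalerA addrACA -!scalerDl. Qed.

End TwoVariables.

Section Field.

Variable K : fieldType.

Lemma scaled_euler_eigen (charK0 : [pchar K] =i pred0) (a : K)
    (p : {mpoly K[2]}) :
  a != 0 -> scaled_euler a p = a *: p -> p = linform p@_U_(0) p@_U_(1).
Proof.
move=> a0 Dp; apply/mpolyP=> m; rewrite mcoeffD !mcoeffZ !mcoeffX.
have [/eqP/mdeg1P[i /eqP ->]|dm] := eqVneq (mdeg m) 1%N.
  have [->|i0] := eqVneq i 0; first by rewrite eqxx eq_mnm1 mulr1 mulr0 addr0.
  have -> : i = 1 by apply/val_inj; case: i i0 => [[|[|]]].
  by rewrite eqxx eq_mnm1 mulr1 mulr0 add0r.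
have neU i : (U_(i)%MM == m) = false.
  by apply: contra_neqF dm => /eqP <-; rewrite mdeg1.
rewrite !neU !mulr0 addr0; apply/eqP.
(* The coefficient at [m] satisfies [a * (mdeg m - 1) * p@_m = 0]. The middle factor is -1 in degree
   0 and a nonzero natural number in degree at least 2, hence invertible in characteristic zero. *)
have /eqP := congr1 (mcoeff m) Dp.
rewrite mcoeff_scaled_euler mcoeffZ -mulrA -subr_eq0 -mulrBr mulf_eq0.
rewrite (negPf a0) /= -[X in _ - X]mul1r -mulrBl mulf_eq0 => /orP[|//].
case: (mdeg m) dm => [_|n]; first by rewrite sub0r oppr_eq0 oner_eq0.
by rewrite eqSS mulrSr addrK ((pcharf0P K).1 charK0) => /negPf ->.
Qed.

(** The left inverse is given by the inverse matrix, the adjugate divided by the determinant; it is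
    enough to check the composite on the two variables. *)
Lemma endo_linformK (x y z t : K) : x * t - y * z != 0 ->
  cancel (endo (linform x y) (linform z t))
    (endo (linform (t / (x * t - y * z)) (- y / (x * t - y * z)))
          (linform (- z / (x * t - y * z)) (x / (x * t - y * z)))).
Proof.
move=> d0; set f := endo _ _; set g := endo _ _.
have gL : linear g by exact: endo_linear.
have [g1 gM] : monoid_morphism g by exact: endo_monoid_morphism.
have fL : linear f by exact: endo_linear.
have [f1 fM] : monoid_morphism f by exact: endo_monoid_morphism.
suff : g \o f =1 id by [].
apply: alg_morphism_ext.
- by move=> c p q; rewrite /= fL gL.
- by split=> [|p q]; rewrite /= ?f1 ?fM ?gM.
- by [].
- by [].
- rewrite -[LHS]/(g (f varX)) /f endo_varX /g endo_linform.
  by rewrite linform_comb -linformX; congr linform; field; exact: d0.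
- rewrite -[LHS]/(g (f varY)) /f endo_varY /g endo_linform.
  by rewrite linform_comb -linformY; congr linform; field; exact: d0.
Qed.

Lemma endo_linform_bij (x y z t : K) : x * t - y * z != 0 ->
  bijective (endo (linform x y) (linform z t)).
Proof.
move=> d0; eexists; first exact: endo_linformK.
set d := x * t - y * z.
(* For the other cancellation, [endo_linformK] is applied to the inverse matrix: its determinant is
   [d^-1], and its own inverse simplifies to the original matrix. *)
have e0 : t / d * (x / d) - (- y / d) * (- z / d) = d^-1 by rewrite /d; field.
have := @endo_linformK (t / d) (- y / d) (- z / d) (x / d).
by rewrite e0 invr_eq0 invrK !mulNr !opprK !divfK //; apply.
Qed.

Lemma endo_linform_inj (x y z t : K) :
  injective (endo (linform x y) (linform z t)) -> x * t - y * z != 0.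
Proof.
move=> finj; apply/eqP=> d0.
(* A row vector [(u, v)] killed by the matrix gives a linear form in the kernel of the
   endomorphism. *)
have fker u v : u * x + v * z = 0 -> u * y + v * t = 0 -> u = 0 /\ v = 0.
  move=> ux uy; apply: linform_eq0; apply: finj.
  rewrite endo_linform linform_comb ux uy /linform !scale0r addr0.
  by rewrite (linear_fun0 (@endo_linear _ _ _)).
(* When the determinant vanishes, the rows [(t, - y)] and [(- z, x)] of the adjugate are such
   vectors, so the whole matrix is zero. It then kills [(1, 1)] too, which is absurd. *)
have [t0 /eqP] : t = 0 /\ - y = 0.
  by apply: fker; [rewrite -d0|]; ring.
rewrite oppr_eq0 => /eqP y0.
have [/eqP] : - z = 0 /\ x = 0.
  by apply: fker; [|rewrite -d0]; ring.
rewrite oppr_eq0 => /eqP z0 x0.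
have [/eqP] : (1 : K) = 0 /\ (1 : K) = 0.
  by apply: fker; rewrite ?x0 ?y0 ?z0 ?t0; ring.
by rewrite oner_eq0.
Qed.

End Field.

Theorem theorem3p7 (K : closedFieldType) (charK0 : [pchar K] =i pred0)
    (a : K) (a_neq0 : a != 0) (rho : {mpoly K[2]} -> {mpoly K[2]}) :
  isotropy (scaled_euler a) rho <->
  exists alpha beta gamma delta : K,
    alpha * delta - beta * gamma != 0 /\
    rho =1 endo (alpha *: varX + beta *: varY) (gamma *: varX + delta *: varY).
Proof.
split=> [[[rhoL rhoM rho_bij] rhoD]|[x [y [z [t [d0 rhoE]]]]]].
  have rhoX : scaled_euler a (rho varX) = a *: rho varX.
    by rewrite -[LHS]rhoD /comp scaled_euler_varX (linear_funZ rhoL).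
  have rhoY : scaled_euler a (rho varY) = a *: rho varY.
    by rewrite -[LHS]rhoD /comp scaled_euler_varY (linear_funZ rhoL).
  have EX := scaled_euler_eigen charK0 a_neq0 rhoX.
  have EY := scaled_euler_eigen charK0 a_neq0 rhoY.
  set x := (rho varX)@__ in EX; set y := (rho varX)@__ in EX.
  set z := (rho varY)@__ in EY; set t := (rho varY)@__ in EY.
  have rhoE : rho =1 endo (linform x y) (linform z t).
    apply: alg_morphism_ext => //; first exact: endo_linear.
    - exact: endo_monoid_morphism.
    - by rewrite endo_varX.
    - by rewrite endo_varY.
  exists x, y, z, t; split=> //; apply: endo_linform_inj.
  exact: eq_inj (bij_inj rho_bij) rhoE.
(* Conversely, everything is proved for the substitution itself and then transferred to [rho], which
   equals it only pointwise. *)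
have fL := endo_linear (linform x y) (linform z t).
have fM := endo_monoid_morphism (linform x y) (linform z t).
have fD : endo (linform x y) (linform z t) \o scaled_euler a =1
          scaled_euler a \o endo (linform x y) (linform z t).
  apply: commute_derivation => //.
  - rewrite scaled_euler_varX (linear_funZ fL) endo_varX.
    by rewrite scaled_euler_linform.
  - rewrite scaled_euler_varY (linear_funZ fL) endo_varY.
    by rewrite scaled_euler_linform.
split; last by move=> p /=; rewrite !rhoE; apply: fD.
split.
- by move=> c p q; rewrite !rhoE; apply: fL.
- by case: fM => f1 fM; split=> [|p q]; rewrite !rhoE.
- by apply: (eq_bij (endo_linform_bij d0)) => p; rewrite rhoE.
Qed.
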